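(* For a subset $A$ of a Polish group $X$ the following conditions are equivalent: (1) $A$ is Haar-thin; (2) $A$ is injectively Haar-thin; (3) $A-A$ is not a neighborhood of zero in $X$.
   Context: All groups are Abelian, written additively. A Polish group is a topological group whose underlying space is Polish (separable and completely metrizable). $A-A=\{a-b:a,b\in A\}$; ''zero'' is the neutral element of $X$. $\omega=\{0,1,2,\dots\}$ and $2^\omega=\{0,1\}^\omega$ is the Cantor cube with the product topology. A subset $T\subset 2^\omega$ is called thin if for every $n\in\omega$ the restriction to $T$ of the projection $2^\omega\to 2^{\omega\setminus\{n\}}$, $x\mapsto x|_{\omega\setminus\{n\}}$, is injective. A subset $A$ of a topological group $X$ is called Haar-thin (resp. injectively Haar-thin) if there exists a continuous map (resp. an injective continuous map) $f:2^\omega\to X$ such that for every $x\in X$ the preimage $f^{-1}(A+x)$ is thin in $2^\omega$.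
   Formalization: The formal theorem excludes the case where A is empty and X is discrete; there the claim is false, since the empty set is Haar-thin and its difference set is empty, but a discrete Polish group is countable and admits no injective map from the Cantor cube. *)

(* Defs.v *)
From mathcomp Require Import all_boot all_order all_algebra.
From mathcomp Require Import all_classical all_reals all_analysis.

Set Implicit Arguments.
Unset Strict Implicit.
Unset Printing Implicit Defensive.

Import Order.TTheory GRing.Theory Num.Theory.

Local Open Scope classical_set_scope.
Local Open Scope ring_scope.

Definition is_metric (R : realType) (X : Type) (d : X -> X -> R) : Prop :=
  [/\ forall x y, 0 <= d x y,
      forall x y, d x y = 0 <-> x = y,
      forall x y, d x y = d y x
    & forall x y z, d x z <= d x y + d y z].

Definition metric_induces_topology (R : realType) (X : topologicalType)
    (d : X -> X -> R) : Prop :=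
  forall (x : X) (U : set X),
    nbhs x U <-> exists2 e : R, 0 < e & [set y | d x y < e] `<=` U.

Definition complete_metric (R : realType) (X : topologicalType)
    (d : X -> X -> R) : Prop :=
  forall u : nat -> X,
    (forall e : R, 0 < e ->
      exists N : nat, forall m n : nat,
        (N <= m)%N -> (N <= n)%N -> d (u m) (u n) < e) ->
    exists l : X, u n @[n --> \oo] --> l.

Definition completely_metrizable (R : realType) (X : topologicalType) : Prop :=
  exists d : X -> X -> R,
    [/\ is_metric d, metric_induces_topology d & complete_metric d].

Definition separable (X : topologicalType) : Prop :=
  exists2 D : set X, countable D & dense D.

Definition polish (R : realType) (X : topologicalType) : Prop :=
  separable X /\ completely_metrizable R X.

Definition discrete (X : topologicalType) : Prop :=
  forall S : set X, open S.

Definition forget_coord (n : nat) (x : cantor_space) :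
    {m : nat | m != n} -> bool :=
  fun m => x (val m).

Definition thin (T : set cantor_space) : Prop :=
  forall n : nat, {in T &, injective (@forget_coord n)}.

Definition translate (X : zmodType) (A : set X) (x : X) : set X :=
  [set a + x | a in A].

Definition difference_set (X : zmodType) (A : set X) : set X :=
  [set a - b | a in A & b in A].

Definition haar_thin (X : topologicalZmodType) (A : set X) : Prop :=
  exists f : cantor_space -> X,
    continuous f /\ forall x : X, thin (f @^-1` translate A x).

Definition injectively_haar_thin (X : topologicalZmodType) (A : set X) : Prop :=
  exists f : cantor_space -> X,
    [/\ injective f, continuous f
      & forall x : X, thin (f @^-1` translate A x)].

(* Main.v *)
Require Import Defs.
From mathcomp Require Import all_boot all_order all_algebra.
From mathcomp Require Import all_classical all_reals all_analysis.
From mathcomp Require Import lra.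
Import Order.TTheory GRing.Theory Num.Theory.

(** Two points of the Cantor cube that differ only at [n] lie together in some
    preimage [f @^-1` translate A x] exactly when the difference of their images
    lies in [A - A]; so [f] witnesses Haar-thinness iff such differences always
    avoid [A - A].

    If [A - A] is a neighborhood of zero, no continuous [f] can do this: the
    points with a single nonzero coordinate [n] tend to the zero sequence, so
    [f] of such a point minus [f] of the zero sequence is eventually in [A - A]
    ([haar_thin_difference]).

    If [A - A] is not a neighborhood of zero, there are elements [x n] outside
    [A - A] tending to zero as fast as desired, and one takes
    [f c = \sum_n c n * x n] ([exists_cube_avoiding]): changing the coordinate
    [n] changes [f c] by exactly [x n], up to sign. Convergence of the series is
    the delicate point, because the complete metric [d] need not be invariant
    under translations, so smallness of [x n] says nothing about its effect far
    from zero. But only finitely many partial sums exist at stage [n], hence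
    [x n] can be chosen to move each of them by less than [e n]
    ([exists_rapid_steps]). The bound [e n.+1] is chosen afterwards, so small
    that all the later steps cannot undo the step [x n]; this makes [f]
    injective, provided that [x n] is nonzero. For nonempty [A] that is automatic,
    since zero is in [A - A]; for empty [A] it is possible because the group is
    then not discrete. *)

(** * The Cantor cube *)

Local Open Scope classical_set_scope.
Local Open Scope ring_scope.

Lemma cylinder_nbhs (n : nat) (c : cantor_space) :
  nbhs c [set c' : cantor_space | forall k, (k < n)%N -> c' k = c k].
Proof.
elim: n => [|n IH]; first by apply: filterS filterT.
have Hn : nbhs c [set c' : cantor_space | c' n = c n].
  have /(_ [set c n]) := @proj_continuous nat (fun=> bool) n c.
  by apply; exact: discrete_set1.
apply: filterS (filterI IH Hn) => c' [/= H1 H2] k.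
by rewrite ltnS leq_eqVlt => /predU1P[->//|]; exact: H1.
Qed.

Definition unit_seq (n : nat) : cantor_space := fun m => m == n.

Lemma unit_seq_cvg : unit_seq n @[n --> \oo] --> ((fun=> false) : cantor_space).
Proof.
apply/(@pointwise_cvgP nat bool _ (fun=> false)) => k.
apply: cvg_near_cst; exists k.+1 => // n /= kn.
by rewrite /unit_seq; apply/negbTE; rewrite neq_ltn kn.
Qed.

Lemma translateP {X : zmodType} (A : set X) (x y : X) :
  translate A x y <-> A (y - x).
Proof.
split=> [[a Aa <-]|Ayx]; first by rewrite addrK.
by exists (y - x) => //; rewrite subrK.
Qed.

(** * Haar-thin sets have small difference sets *)

Lemma haar_thin_difference {X : topologicalZmodType} (A : set X) :
  haar_thin A -> ~ nbhs (0 : X) (difference_set A).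
Proof.
move=> [f [fc fthin]] nA.
set z : cantor_space := fun=> false.
have fcvg : f (unit_seq n) - f z @[n --> \oo] --> (0 : X).
  rewrite -(subrr (f z)).
  apply: (@continuous2_cvg _ _ _ _ _ _ _ _ (fun a b : X => a - b)).
  - exact: (@sub_continuous X (f z, f z)).
  - exact: (continuous_cvg _ (fc z) unit_seq_cvg).
  - exact: cvg_cst.
(* An equality of differences in [A - A] is a common translate of [A]. *)
have [n _ /(_ n (leqnn n))] := fcvg _ nA.
move=> [a Aa [b Ab ab]].
have eqx : f (unit_seq n) - a = f z - b.
  by apply/eqP; rewrite subr_eq addrAC -addrA ab addrC subrK.
have eq_pz : unit_seq n = z.
  apply: (fthin (f z - b) n); rewrite ?inE.
  - by apply/translateP; rewrite -eqx opprB addrC subrK.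
  - by apply/translateP; rewrite opprB addrC subrK.
  - by apply: funext => -[m /= mn]; rewrite /forget_coord /=; apply: negbTE.
by have := congr1 (@^~ n) eq_pz; rewrite /unit_seq eqxx.
Qed.

(** * Subset sums with rapidly decreasing steps *)

Lemma exists_lower_bound {R : realType} {T : eqType}
    (h : T -> R) (S : seq T) (b : R) :
  0 < b -> (forall s, s \in S -> 0 < h s) ->
  exists2 e : R, 0 < e <= b & forall s, s \in S -> e < h s.
Proof.
move=> b0; elim: S => [|s S IH] hS; first by exists b; rewrite ?b0 ?lexx.
have [|e /andP[e0 eb] eS] := IH.
  by move=> t tS; apply: hS; rewrite inE tS orbT.
have hs : 0 < h s by apply: hS; rewrite mem_head.
exists (Num.min e (h s / 2)).
  by rewrite lt_min e0 ge_min eb divr_gt0.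
move=> t; rewrite inE gt_min => /predU1P[->|/eS->//].
by apply/orP; right; lra.
Qed.

Definition subset_sum {X : zmodType} (x : nat -> X) (c : nat -> bool)
    (n : nat) : X :=
  \sum_(i < n) x i *+ c i.

Lemma subset_sumS {X : zmodType} (x : nat -> X) (c : nat -> bool) (n : nat) :
  subset_sum x c n.+1 = subset_sum x c n + x n *+ c n.
Proof. by rewrite /subset_sum big_ord_recr. Qed.

Lemma eq_subset_sum {X : zmodType} (x : nat -> X) (c c' : nat -> bool) (n : nat) :
  (forall k, (k < n)%N -> c k = c' k) -> subset_sum x c n = subset_sum x c' n.
Proof. by move=> cc'; apply: eq_bigr => i _; rewrite cc'. Qed.

Lemma small_translation {R : realType} {X : topologicalZmodType} (d : X -> X -> R)
    (S : seq X) (e : R) :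
  metric_induces_topology d -> 0 < e ->
  nbhs (0 : X) [set x | forall s, s \in S -> d s (s + x) < e].
Proof.
move=> dtop e0; elim: S => [|s S IH]; first by apply: filterS filterT.
have Hs : nbhs (0 : X) [set x | d s (s + x) < e].
  have scvg : s + x @[x --> (0 : X)] --> s.
    rewrite -[X in _ --> X]addr0.
    apply: (@continuous2_cvg _ _ _ _ _ _ _ _ (fun a b : X => a + b)).
    - exact: (@add_continuous X (s, 0)).
    - exact: cvg_cst.
    - exact: cvg_id.
  by apply: (scvg [set y | d s y < e]); apply/dtop; exists e.
apply: filterS (filterI IH Hs) => x [/= H1 H2] t.
by rewrite inE => /predU1P[->//|]; exact: H1.
Qed.

(** The recursion carries the finite list of all partial sums reached so far,
    together with the current bound [e n]. The upper bound on a step gives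
    convergence. In the lower bound the factor 4 is twice the 2 in
    [\sum_(k > n) e k <= 2 * e n.+1]: the tails of two series that part at stage
    [n] are together shorter than the step between them. *)
Lemma exists_rapid_steps {R : realType} {X : topologicalZmodType} (d : X -> X -> R)
    (B : set X) :
  is_metric d -> metric_induces_topology d -> B 0 -> ~ nbhs (0 : X) B ->
  exists (x : nat -> X) (e : nat -> R),
    [/\ forall n, ~ B (x n), forall n, 0 < e n, e 0 = 1,
        forall n, e n.+1 <= e n / 2
      & forall n c,
          4 * e n.+1 < d (subset_sum x c n) (subset_sum x c n + x n) < e n].
Proof.
move=> [d_ge0 d_eq0 _ _] dtop B0 nB.
pose step (st : seq X * R) (nx : X * R) := 0 < st.2 ->
  [/\ ~ B nx.1, 0 < nx.2 <= st.2 / 2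
    & forall s, s \in st.1 -> 4 * nx.2 < d s (s + nx.1) < st.2].
have /choice[g gP] : forall st, exists nx, step st nx.
  move=> [S e]; have [e0|ne0] := pselect (0 < e); last by exists (0, 0).
  have [x [Bx xS]] : exists x, ~ B x /\ forall s, s \in S -> d s (s + x) < e.
    apply: contrapT => nx; apply: nB.
    apply: filterS (small_translation d S e dtop e0) => x xS.
    by apply: contrapT => Bx; apply: nx; exists x.
  have x0 : x != 0 by apply/eqP => x0; apply: Bx; rewrite x0.
  have [||e' e'b e'S] := @exists_lower_bound R X (fun s => d s (s + x) / 4) S (e / 2).
  - by rewrite divr_gt0.
  - move=> s _; rewrite divr_gt0// lt_neqAle d_ge0 andbT eq_sym.
    apply/eqP => /d_eq0/eqP; rewrite -[X in X == _]addr0 => /eqP/addrI/esym/eqP.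
    by rewrite (negbTE x0).
  exists (x, e') => _; split=> // s sS /=; rewrite xS// andbT.
  by have := e'S _ sS; lra.
pose next st := (st.1 ++ [seq s + (g st).1 | s <- st.1], (g st).2).
pose st n := iter n next ([:: 0], 1).
have st0 n : 0 < (st n).2.
  by elim: n => [|n IH] /=; [exact: ltr01|have [_ /andP[]] := gP _ IH].
pose x n := (g (st n)).1.
have sumS c n : subset_sum x c n \in (st n).1.
  elim: n => [|n IH]; first by rewrite /subset_sum big_ord0 mem_head.
  rewrite subset_sumS /= mem_cat; case: (c n); last by rewrite addr0 IH.
  by apply/orP; right; apply/mapP; exists (subset_sum x c n).
exists x, (fun n => (st n).2); split=> // n.
- by have [] := gP _ (st0 n).
- by have [_ /andP[]] := gP _ (st0 n).
- by move=> c; have [_ _ stepS] := gP _ (st0 n); apply: stepS; exact: sumS.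
Qed.

(** * The limit map and its injectivity *)

(** The steps are dominated by a geometric series, uniformly in [c]; so [u]
    converges uniformly, and each [u ^~ n] is locally constant on the cube. *)
Lemma exists_limit_map {R : realType} {X : topologicalType} (d : X -> X -> R)
    (u : cantor_space -> nat -> X) (e : nat -> R) :
  is_metric d -> metric_induces_topology d -> complete_metric d ->
  (forall n (c c' : cantor_space), (forall k, (k < n)%N -> c k = c' k) ->
     u c n = u c' n) ->
  (forall c n, d (u c n) (u c n.+1) <= e n) ->
  (forall n, 0 < e n) -> e 0 = 1 -> (forall n, e n.+1 <= e n / 2) ->
  exists f : cantor_space -> X,
    [/\ continuous f, forall c, u c n @[n --> \oo] --> f c
      & forall c n, d (u c n) (f c) <= 2 * e n].
Proof.
move=> [d_ge0 d_eq0 dC d_tri] dtop dcompl u_loc u_step e_gt0 e0 e_half.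
have e_small (r : R) : 0 < r -> exists N, forall n, (N <= n)%N -> e n < r.
  move=> r0; have [N _ HN] := @near_infty_natSinv_expn_lt R (PosNum r0).
  exists N => n /HN; apply: le_lt_trans.
  elim: n => [|n IH]; first by rewrite expr0 divr1 e0.
  apply: le_trans (e_half n) _.
  by rewrite exprSr invfM mulrA; lra.
(* The term [2 * e (n + k)] makes the bound inductive: it pays for the
   remaining steps. *)
have tail c n k : d (u c n) (u c (n + k)%N) + 2 * e (n + k)%N <= 2 * e n.
  elim: k => [|k IH]; first by rewrite addn0 (d_eq0 _ _).2// add0r.
  rewrite addnS.
  have := d_tri (u c n) (u c (n + k)%N) (u c (n + k).+1).
  by have := u_step c (n + k)%N; have := e_half (n + k)%N; lra.
have tail_le c n m : (n <= m)%N -> d (u c n) (u c m) <= 2 * e n.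
  by move=> /subnKC <-; have := tail c n (m - n)%N; have := e_gt0 (n + (m - n))%N; lra.
have /choice[f fP] : forall c, exists l : X, u c n @[n --> \oo] --> l.
  move=> c; apply: dcompl => r r0.
  have [|N HN] := e_small (r / 4); first by rewrite divr_gt0.
  exists N => m n Nm Nn.
  have := d_tri (u c m) (u c N) (u c n); rewrite (dC _ (u c N)).
  by have := tail_le c _ _ Nm; have := tail_le c _ _ Nn; have := HN _ (leqnn N); lra.
have f_close c n : d (u c n) (f c) <= 2 * e n.
  apply/ler_addgt0Pr => r r0.
  have /fP [M _ HM] : nbhs (f c) [set y | d (f c) y < r] by apply/dtop; exists r.
  have := HM (maxn M n) (leq_maxl _ _) => /= near_f.
  have := tail_le c n (maxn M n) (leq_maxr _ _).
  have := d_tri (u c n) (u c (maxn M n)) (f c).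
  by rewrite (dC (u c (maxn M n)) (f c)); lra.
exists f; split=> // c U /dtop[r r0 rU].
have [|N HN] := e_small (r / 4); first by rewrite divr_gt0.
apply: filterS (cylinder_nbhs N c) => c' cc'; apply: rU => /=.
have := d_tri (f c) (u c N) (f c'); rewrite (dC (f c) (u c N)).
have := f_close c' N; rewrite (u_loc _ _ _ cc') => H1.
by have := f_close c N; have := HN _ (leqnn N); lra.
Qed.

Lemma metric_hausdorff {R : realType} {X : topologicalType} (d : X -> X -> R) :
  is_metric d -> metric_induces_topology d -> hausdorff_space X.
Proof.
move=> [d_ge0 d_eq0 dC d_tri] dtop p q pq; apply/d_eq0/eqP.
rewrite eq_le d_ge0 andbT; apply/ler_addgt0Pr => r r0; rewrite add0r.
have r20 : 0 < r / 2 by rewrite divr_gt0.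
have [||z [/= pz qz]] := pq [set y | d p y < r / 2] [set y | d q y < r / 2].
- by apply/dtop; exists (r / 2).
- by apply/dtop; exists (r / 2).
by have := d_tri p z q; rewrite (dC z); lra.
Qed.

(** The differences are controlled for [c n] true and [c' n] false only, which
    frees [B] from being symmetric. *)
Lemma exists_cube_avoiding {R : realType} {X : topologicalZmodType} (B : set X) :
  completely_metrizable R X -> B 0 -> ~ nbhs (0 : X) B ->
  exists f : cantor_space -> X,
    [/\ injective f, continuous f
      & forall n (c c' : cantor_space), c n -> ~~ c' n ->
          (forall m, m != n -> c m = c' m) -> ~ B (f c - f c')].
Proof.
move=> [d [dm dtop dcompl]] B0 nB.
have [x [e [Bx e_gt0 e0 e_half stepP]]] := exists_rapid_steps d B dm dtop B0 nB.
have [_ d_eq0 dC d_tri] := dm.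
have [|c n|f [fcont fcvg fclose]] :=
    exists_limit_map d (subset_sum x) e dm dtop dcompl _ _ e_gt0 e0 e_half.
- by move=> n c c'; exact: eq_subset_sum.
- rewrite subset_sumS; case: (c n); first by have /andP[_ /ltW] := stepP n c.
  by rewrite addr0 (d_eq0 _ _).2// ltW.
exists f; split=> //.
- have sep n (c c' : cantor_space) : (forall k, (k < n)%N -> c k = c' k) ->
      c n -> ~~ c' n -> f c <> f c'.
    move=> cc' cn c'n fcc'.
    have := fclose c n.+1; have := fclose c' n.+1.
    rewrite !subset_sumS cn (negbTE c'n) addr0 -fcc'.
    rewrite -(eq_subset_sum x c c' n cc') => H1 H2.
    have /andP[H3 _] := stepP n c.
    have := d_tri (subset_sum x c n) (f c) (subset_sum x c n + x n).
    by rewrite (dC (f c) (subset_sum x c n + x n)); lra.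
  move=> c c' fcc'; apply: contrapT => ncc'.
  (* The least coordinate where [c] and [c'] differ is where the sums part. *)
  have ex : exists n, c n != c' n.
    apply: contrapT => nex; apply: ncc'; apply: funext => n.
    by apply/eqP/negP => /negP neq; apply: nex; exists n.
  have [n neqn min_n] := ex_minnP ex.
  have cc' k : (k < n)%N -> c k = c' k.
    by move=> kn; apply/eqP; apply: contraLR kn => /min_n; rewrite -leqNgt.
  case cn : (c n); case c'n : (c' n); move: neqn; rewrite cn c'n //= => _.
  + by apply: (sep n c c') => //; rewrite ?cn ?c'n.
  + by apply: (sep n c' c) => //; rewrite ?cn ?c'n // => k /cc'.
move=> n c c' cn c'n cc'.
suff -> : f c - f c' = x n by exact: Bx.
apply/eqP; rewrite subr_eq addrC; apply/eqP.
apply: (cvg_unique (metric_hausdorff d dm dtop) (fcvg c)).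
(* The partial sums past [n] differ by [x n], hence so do the limits. *)
have sumE k : (n < k)%N -> subset_sum x c k = subset_sum x c' k + x n.
  elim: k => // k IH; rewrite ltnS leq_eqVlt => /predU1P[<-|nk].
    rewrite !subset_sumS cn (negbTE c'n) addr0; congr (_ + _).
    by apply: eq_subset_sum => i ik; rewrite cc'// neq_ltn ik.
  by rewrite !subset_sumS IH// addrAC cc'// neq_ltn nk orbT.
apply: (@cvg_trans _ (subset_sum x c' k + x n @[k --> \oo])).
  apply: near_eq_cvg; exists n.+1 => // k /= nk.
  by rewrite sumE.
apply: (@continuous2_cvg _ _ _ _ _ _ _ _ (fun a b : X => a + b)).
- exact: (@add_continuous X (f c', x n)).
- exact: fcvg.
- exact: cvg_cst.
Qed.

(** * From a small difference set to an injective witness *)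

Lemma nbhs0_set1_discrete {X : topologicalZmodType} :
  nbhs (0 : X) [set 0] -> discrete X.
Proof.
move=> n0 S; rewrite openE => s Ss; rewrite /interior.
have scvg : x - s @[x --> s] --> (0 : X).
  rewrite -(subrr s).
  apply: (@continuous2_cvg _ _ _ _ _ _ _ _ (fun a b : X => a - b)).
  - exact: (@sub_continuous X (s, s)).
  - exact: cvg_id.
  - exact: cvg_cst.
have : nbhs s [set x | x - s = 0] by exact: scvg n0.
by apply: filterS => x /= /eqP; rewrite subr_eq0 => /eqP ->.
Qed.

(** Adding zero to [A - A] makes the steps nonzero. This changes nothing for
    nonempty [A]; for empty [A] the enlarged set [[set 0]] still fails to be a
    neighborhood of zero, as the group is not discrete. *)
Lemma difference_injectively_haar_thin {R : realType}
    {X : topologicalZmodType} (A : set X) :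
  completely_metrizable R X -> A !=set0 \/ ~ discrete X ->
  ~ nbhs (0 : X) (difference_set A) -> injectively_haar_thin A.
Proof.
move=> Xm nondeg nA.
have nB : ~ nbhs (0 : X) (0 |` difference_set A).
  move=> nB; have [[a Aa]|A0] := pselect (A !=set0).
    apply: nA; apply: filterS nB => y [->|//].
    by exists a => //; exists a => //; rewrite subrr.
  case: nondeg => // -[]; apply: nbhs0_set1_discrete.
  by apply: filterS nB => y [//|[a Aa _]]; case: A0; exists a.
have [f [finj fcont favoid]] := exists_cube_avoiding _ Xm (or_introl erefl) nB.
exists f; split=> // y n c c'; rewrite !inE => /translateP Ac /translateP Ac' cc'.
have agree m : m != n -> c m = c' m.
  by move=> mn; have := congr1 (@^~ (exist _ m mn)) cc'.
(* Stated for generic points because it is needed in both orders of [c] and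
   [c']: which of the two has the coordinate [n] true is not known. *)
have ndiff (b b' : cantor_space) : A (f b - y) -> A (f b' - y) ->
    (forall m, m != n -> b m = b' m) -> ~ (b n /\ ~~ b' n).
  move=> Ab Ab' bb' [bn b'n]; apply: (favoid n b b' bn b'n bb'); right.
  exists (f b - y) => //; exists (f b' - y) => //.
  by rewrite opprB addrA subrK.
apply: funext => m; have [->|/agree//] := eqVneq m n.
case cn : (c n); case c'n : (c' n) => //.
- by case: (ndiff c c' Ac Ac' agree); rewrite cn c'n.
- by case: (ndiff c' c Ac' Ac (fun m mn => esym (agree m mn))); rewrite cn c'n.
Qed.

(* The hypothesis [nondegenerate] excludes only the empty subset of a discrete
   group, for which the equivalence fails: the empty set is Haar-thin and its
   difference set is not a neighborhood of zero, but a discrete Polish group is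
   countable, so there is no injective map from the Cantor cube to it. *)
Theorem theorem9p6 (R : realType) (X : topologicalZmodType)
    (polishX : polish R X) (A : set X)
    (nondegenerate : A !=set0 \/ ~ discrete X) :
  [<-> haar_thin A;
       injectively_haar_thin A;
       ~ nbhs (0 : X) (difference_set A)].
Proof.
have [_ Xm] := polishX.
have inj_thin : injectively_haar_thin A -> haar_thin A.
  by move=> [f [_ fcont fthin]]; exists f.
have diff_inj := difference_injectively_haar_thin A Xm nondegenerate.
tfae.
- by move=> /haar_thin_difference/diff_inj.
- by move=> /inj_thin/haar_thin_difference.
- by move=> /diff_inj/inj_thin.
Qed.
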